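(* Let $(\bar x,\bar\lambda)=(\bar x^1,\dots,\bar x^N,\bar\lambda^1,\dots,\bar\lambda^N)\in S_{\rm KKT}(\bar p)$, $\bar p=(\bar u,\bar v,\bar w)$. The following are equivalent: (i) $S_{\rm KKT}$ has a continuously differentiable single-valued localization around $\bar p$ for $(\bar x,\bar\lambda)$; (ii) $T_{\rm KKT}$ has a continuously differentiable single-valued localization around $(\bar u,\bar v)$ for $(\bar x,\bar\lambda)$.
   Context: Nash equilibrium problem (NEP) with canonical perturbations. There are $N$ players; player $k$ has strategy $x^k\in\mathbb R^{n_k}$; $x=(x^1,\dots,x^N)\in\mathbb R^n$, $n=n_1+\cdots+n_N$; $x^{-k}$ denotes the other players' strategies. Parameters: $p^k=(u^k,v^k,w^k)\in\mathbb R^{m_k}\times\mathbb R^{n_k}\times\mathbb R^{d_k}$, $p=(p^1,\dots,p^N)$, identified with $(u,v,w)\in\mathbb R^{m}\times\mathbb R^n\times\mathbb R^d$, $m=\sum m_k$, $d=\sum d_k$. Given $x^{-k},p^k$, player $k$ solves $$\min_{x^k}\ f^k(x^k,x^{-k};w^k)-\langle v^k,x^k\rangle\ \text{ s.t. } g^k_i(x^k;w^k)=u^k_i\ (i=1,\dots,s_k),\ \ g^k_j(x^k;w^k)\le u^k_j\ (j=s_k+1,\dots,m_k),$$ with $f^k\in C^2(\mathbb R^n\times\mathbb R^{d_k})$, $g^k_i\in C^2(\mathbb R^{n_k}\times\mathbb R^{d_k})$. Lagrangian: $L^k(x^k,x^{-k},\lambda^k;w^k)=f^k(x^k,x^{-k};w^k)+\sum_{i=1}^{m_k}\lambda^k_ig^k_i(x^k;w^k)$.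 KKT mapping: $S_{\rm KKT}(p)$ is the set of $(x,\lambda)\in\mathbb R^n\times\mathbb R^m$ such that for each $k$: $v^k=\nabla_{x^k}L^k(x^k,x^{-k},\lambda^k;w^k)$; $g^k_i(x^k;w^k)=u^k_i$ for $i\le s_k$; and $\lambda^k_j\ge0$, $g^k_j(x^k;w^k)\le u^k_j$, $\lambda^k_j(g^k_j(x^k;w^k)-u^k_j)=0$ for $j>s_k$. The KKT mapping with only tilt perturbations is $T_{\rm KKT}(u,v):=S_{\rm KKT}(u,v,\bar w)$, with $\bar w$ the $w$-component of $\bar p$. A set-valued mapping $\Phi$ has a continuously differentiable single-valued localization around $\bar a$ for $\bar b$ if $\bar b\in\Phi(\bar a)$ and there are neighborhoods $U$ of $\bar a$, $V$ of $\bar b$ such that ${\rm gph}\,\Phi\cap(U\times V)$ is the graph of a continuously differentiable single-valued mapping $U\to V$. *)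

(* Defs.v *)
From HB Require Import structures.
From mathcomp Require Import all_boot all_order all_algebra.
From mathcomp Require Import all_classical all_reals all_analysis.

Set Implicit Arguments.
Unset Strict Implicit.
Unset Printing Implicit Defensive.

Import Order.TTheory GRing.Theory Num.Theory.
Import numFieldNormedType.Exports.

Local Open Scope classical_set_scope.
Local Open Scope ring_scope.

(* C^r on the set U, meant for U open and V finite dimensional: there, since
   'd F x h is linear in h, continuity (resp. C^r regularity) of x |-> 'd F x h
   for each fixed h is continuity (resp. C^r regularity) of x |-> 'd F x for
   the operator norm. *)
Fixpoint is_C (R : realType) (V W : normedModType R) (r : nat) (U : set V)
    (F : V -> W) : Prop :=
  if r is r'.+1 then
    (forall x, U x -> differentiable F x) /\
    (forall h : V, is_C r' U (fun x => 'd F x h))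
  else forall x, U x -> {for x, continuous F}.

(* The neighborhoods are taken open, so that differentiability on U makes
   sense; the values of sigma outside U are irrelevant, and the graph equality
   forces sigma to map U into V. *)
Definition C1_localization (R : realType) (A B : normedModType R)
    (Phi : A -> set B) (a : A) (b : B) : Prop :=
  Phi a b /\
  exists (U : set A) (V : set B) (sigma : A -> B),
    [/\ open_nbhs a U, open_nbhs b V, is_C 1 U sigma &
        [set z : A * B | Phi z.1 z.2] `&` (U `*` V) =
        [set z : A * B | U z.1 /\ z.2 = sigma z.1]].

(* Players are indexed by 'I_N. A family (z^1, ..., z^N) with z^k in R^(q k) is
   a row vector of length \sum_k q k, and z^k is its block submxrow z k. Only
   row vectors are used; gradients are row vectors too. *)

Definition lagrangian (R : realType) (N : nat) (n m d : 'I_N -> nat)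
    (f : forall k, 'rV[R]_(\sum_k n k) * 'rV[R]_(d k) -> R)
    (g : forall k, 'I_(m k) -> 'rV[R]_(n k) * 'rV[R]_(d k) -> R)
    (k : 'I_N) (x : 'rV[R]_(\sum_k n k)) (lam : 'rV[R]_(m k))
    (w : 'rV[R]_(d k)) : R :=
  f k (x, w) + \sum_(i < m k) lam 0 i * g k i (submxrow x k, w).

(* Gradient with respect to the block x^k: tagnat.Rank k i is the position in
   x of the i-th coordinate of x^k. *)
Definition block_grad (R : realType) (N : nat) (n : 'I_N -> nat) (k : 'I_N)
    (F : 'rV[R]_(\sum_k n k) -> R) (x : 'rV[R]_(\sum_k n k)) : 'rV[R]_(n k) :=
  \row_(i < n k) 'D_(delta_mx 0 (tagnat.Rank k i)) F x.

(* Constraint i of player k (counted from 0) is an equality iff i < s k. *)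
Definition S_KKT (R : realType) (N : nat) (n m d s : 'I_N -> nat)
    (f : forall k, 'rV[R]_(\sum_k n k) * 'rV[R]_(d k) -> R)
    (g : forall k, 'I_(m k) -> 'rV[R]_(n k) * 'rV[R]_(d k) -> R)
    (p : 'rV[R]_(\sum_k m k) * 'rV[R]_(\sum_k n k) * 'rV[R]_(\sum_k d k)) :
    set ('rV[R]_(\sum_k n k) * 'rV[R]_(\sum_k m k)) :=
  let: (u, v, w) := p in
  [set z | let: (x, lam) := z in
    forall k : 'I_N,
      let xk := submxrow x k in
      let lamk := submxrow lam k in
      let uk := submxrow u k in
      let wk := submxrow w k in
      [/\ submxrow v k =
            block_grad k (fun y => lagrangian f g y lamk wk) x,
          forall i : 'I_(m k), (i < s k)%N -> g k i (xk, wk) = uk 0 i &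
          forall j : 'I_(m k), (s k <= j)%N ->
            [/\ 0 <= lamk 0 j, g k j (xk, wk) <= uk 0 j &
                lamk 0 j * (g k j (xk, wk) - uk 0 j) = 0]]].

Definition T_KKT (R : realType) (N : nat) (n m d s : 'I_N -> nat)
    (f : forall k, 'rV[R]_(\sum_k n k) * 'rV[R]_(d k) -> R)
    (g : forall k, 'I_(m k) -> 'rV[R]_(n k) * 'rV[R]_(d k) -> R)
    (wbar : 'rV[R]_(\sum_k d k))
    (q : 'rV[R]_(\sum_k m k) * 'rV[R]_(\sum_k n k)) :
    set ('rV[R]_(\sum_k n k) * 'rV[R]_(\sum_k m k)) :=
  S_KKT s f g (q, wbar).

(* Main.v *)
(* Only (ii) => (i) needs an argument. The KKT conditions depend on (u, v) only
   through the residual (u, v) - H((x, lambda), w), where H collects the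
   constraint values and the gradients of the Lagrangians. Hence z = (x, lambda)
   solves the problem for (q, w), q = (u, v), iff it solves the tilted problem at
   the fixed parameter wbar for q - (H(z, w) - H(z, wbar)). If sigma localizes
   T_KKT, the solutions near zbar are therefore the fixed points of
     z |-> sigma (q - (H(z, w) - H(z, wbar))).
   This map does not depend on z when w = wbar, so its z-derivative vanishes at
   the base point; near it, it is a contraction in z whose fixed point is a C^1
   function of (q, w). *)

Require Import Defs.
From HB Require Import structures.
From mathcomp Require Import all_boot all_order all_algebra.
From mathcomp Require Import all_classical all_reals all_analysis.
From mathcomp Require Import lra.

Set Implicit Arguments.
Unset Strict Implicit.
Unset Printing Implicit Defensive.

Import Order.TTheory GRing.Theory Num.Theory.
Import numFieldNormedType.Exports.

Local Open Scope classical_set_scope.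
Local Open Scope ring_scope.

(** * Mean value inequality *)

Section DifferentialNorm.
Variables (R : realType) (V W : normedModType R).

(** Together with [diff_norm], trades the little-o form of differentiability for explicit epsilon
    estimates, the form in which the bounds below are combined. *)
Lemma diff_normP (f : V -> W) (x : V) (L : {linear V -> W}) :
  continuous L ->
  (forall e, 0 < e -> \forall y \near x,
    `|f y - f x - L (y - x)| <= e * `|y - x|) ->
  differentiable f x /\ 'd f x = L :> (V -> W).
Proof.
move=> cL fL.
have fE : f \o shift x = cst (f x) + L +o_ 0 id.
  apply/eqaddoP => _/posnumP[e] /=.
  have := fL _ [gt0 of e%:num]; rewrite (near_shift 0 x).
  apply: filterS => y /=.
  by rewrite /= subr0 addrK /cst /= opprD addrA.
have dE := diff_unique cL fE.
by split=> //; apply/diff_locallyP; rewrite dE.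
Qed.

Lemma diff_norm (f : V -> W) (x : V) (e : R) : differentiable f x -> 0 < e ->
  \forall y \near x, `|f y - f x - 'd f x (y - x)| <= e * `|y - x|.
Proof.
move=> /diff_locally /eqaddoP fE e0; have := fE _ e0.
rewrite [X in _ -> X](near_shift 0 x); apply: filterS => y /=.
by rewrite /= subr0 addrK /cst /= opprD addrA.
Qed.

End DifferentialNorm.

(* For [0 < e], the minimum over [0, 1] of |phi t - phi 0| - (C + e) t can only
   be attained at 1: this function decreases strictly to the right of any
   earlier point. *)
Lemma mean_value_inequality (R : realType) (W : normedModType R)
    (phi : R -> W) (C : R) :
  (forall t : R, 0 <= t <= 1 -> differentiable phi t) ->
  (forall t : R, 0 <= t <= 1 -> `|'d phi t 1| <= C) ->
  `|phi 1 - phi 0| <= C.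
Proof.
move=> dphi phiC; apply/ler_addgt0Pr => e e0.
pose chi (t : R) := `|phi t - phi 0| - (C + e) * t.
have chi_cont : {in `[0, 1]%classic, continuous chi}.
  move=> t; rewrite inE/= in_itv/= => t01; apply: cvgB; last exact: cvgMr.
  apply: cvg_norm; apply: cvgB; last exact: cvg_cst.
  exact/differentiable_continuous/dphi.
have [c] := EVT_min ler01 (continuous_in_subspaceT chi_cont).
rewrite in_itv/= => /andP[c0 c1] chi_min.
have [c_lt1|] := ltP c 1; last first.
  move=> c_ge1; have {c1 c_ge1}cE : c = 1 by apply/eqP; rewrite eq_le c1.
  have := chi_min 0; rewrite in_itv/= lexx ler01 => /(_ isT).
  by rewrite /chi cE subrr normr0 mulr0 subrr mulr1 subr_le0.
exfalso.
have dc : differentiable phi c by apply: dphi; rewrite c0.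
(* The error [e / 2] uses only half of the slack [e]: just to the right of [c] the increment of
   [phi] stays strictly below [(C + e) * (s - c)], against minimality at [c]. *)
have {}dc := diff_norm dc (divr_gt0 e0 (ltr0n R 2)).
near c^'+ => s.
have cs : c < s by near: s; exact: nbhs_right_gt.
have s1 : s <= 1 by near: s; exact: nbhs_right_le.
have : `|phi s - phi c - 'd phi c (s - c)| <= e / 2 * `|s - c|.
  by near: s; exact: cvg_within dc.
rewrite -[X in 'd phi c X]mulr1 [X in 'd phi c X]/((s - c) *: 1) linearZ /=.
have sc : 0 < s - c by rewrite subr_gt0.
rewrite (gtr0_norm sc) => est.
have : `|phi s - phi c| <= (C + e / 2) * (s - c).
  rewrite -[phi s - phi c](subrK ((s - c) *: 'd phi c 1)).
  rewrite (le_trans (ler_normD _ _))// addrC mulrDl lerD//.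
  by rewrite normrZ gtr0_norm// mulrC ler_pM2r// phiC ?c0 ?c1.
have := chi_min s; rewrite in_itv/= s1 (le_trans c0 (ltW cs)) => /(_ isT).
rewrite /chi; have := ler_distD (phi c) (phi s) (phi 0).
have : 0 < e * (s - c) by exact: mulr_gt0.
lra.
Unshelve. all: by end_near. Qed.

(* A substitute for finite dimension: it gives the passage from pointwise to
   operator norm continuity without choosing a basis. *)
Definition finitely_spanned (R : realType) (V : normedModType R) :=
  exists (I : finType) (e : I -> V), forall v, exists2 c : I -> R,
    v = \sum_i c i *: e i & forall i, `|c i| <= `|v|.

Lemma finitely_spanned_rV (R : realType) (n : nat) :
  finitely_spanned 'rV[R]_n.
Proof.
exists 'I_n, (fun i => delta_mx 0 i) => v.
exists (fun i => v 0 i); first exact: row_sum_delta.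
move=> i; rewrite [leRHS]/Num.Def.normr/= mx_normrE.
exact: (le_bigmax _ _ (0, i)).
Qed.

Lemma finitely_spanned_pair (R : realType) (V W : normedModType R) :
  finitely_spanned V -> finitely_spanned W ->
  finitely_spanned (V * W)%type.
Proof.
move=> [I [e eP]] [J [e' e'P]].
exists (I + J)%type, (fun k => match k with inl i => (e i, 0) | inr j => (0, e' j) end).
move=> [v w]; have [c vE cv] := eP v; have [c' wE cw] := e'P w.
exists (fun k => match k with inl i => c i | inr j => c' j end); last first.
  by case=> i; rewrite prod_normE le_max ?cv// cw orbT.
rewrite big_sumType/=; apply: injective_projections.
- rewrite raddfD !raddf_sum/= [X in _ + X]big1 ?addr0// => j _.
  by rewrite scaler0.
- rewrite raddfD !raddf_sum/= [X in X + _]big1 ?add0r// => j _.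
  by rewrite scaler0.
Qed.

(** Continuity of [y |-> 'd F y (b i)] on the finitely many spanning vectors is summed with
    coefficients bounded by [|h|], which makes the estimate uniform in [h]. *)
Lemma diff_near_uniform (R : realType) (V W : normedModType R) (U : set V)
    (F : V -> W) (x : V) (e : R) :
  finitely_spanned V -> open U -> is_C 1 U F -> U x -> 0 < e ->
  \forall y \near x, U y /\
    forall h, `|'d F y h - 'd F x h| <= e * `|h|.
Proof.
move=> [I [b bP]] oU [_ cF] Ux e0.
(* The successor keeps the denominator nonzero when [I] is empty. *)
have e'0 : 0 < e / #|I|.+1%:R by exact: divr_gt0.
have cb i : \forall y \near x, `|'d F x (b i) - 'd F y (b i)| <= e / #|I|.+1%:R.
  exact: (cvgrPdist_le _ _).1 (cF (b i) x Ux) _ e'0.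
near=> y; split; first by near: y; exact: open_nbhs_nbhs.
move=> h; have [c hE ch] := bP h.
rewrite [in leLHS]hE !linear_sum/=. rewrite -big_split/=.
apply: (le_trans (ler_norm_sum _ _ _)).
have -> : e * `|h| = #|I|.+1%:R * (`|h| * (e / #|I|.+1%:R)).
  by rewrite mulrC [RHS]mulrCA [#|I|.+1%:R * _]mulrCA divff ?mulr1.
apply: (@le_trans _ _ (\sum_(i in I) `|h| * (e / #|I|.+1%:R))); last first.
  rewrite sumr_const -[leLHS]mulr_natl ler_wpM2r ?ler_nat//.
  by rewrite mulr_ge0// ltW.
apply: ler_sum => i _.
rewrite 2!linearZ/= -scalerBr normrZ distrC ler_pM//.
by move: (i); near: y; exact: filter_forall.
Unshelve. all: by end_near. Qed.

(** The mean value inequality is applied to [F - L] along the segment [a] from [z] to [y], which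
    stays in the ball by convexity. *)
Lemma ball_strict_diff (R : realType) (V W : normedModType R)
    (F : V -> W) (L : {linear V -> W}) (x : V) (r e : R) :
  continuous L ->
  (forall y, ball x r y ->
    differentiable F y /\ forall h, `|'d F y h - L h| <= e * `|h|) ->
  forall y z, ball x r y -> ball x r z ->
    `|F y - F z - L (y - z)| <= e * `|y - z|.
Proof.
move=> cL dF y z xy xz.
pose a : R -> V := ( *:%R ^~ (y - z)) + cst z.
pose phi : R -> W := (F - (L : V -> W)) \o a.
have ball_a (t : R) : 0 <= t <= 1 -> ball x r (a t).
  move=> /andP[t0 t1]; rewrite -ball_normE /=.
  have -> : x - a t = t *: (x - y) + (1 - t) *: (x - z).
    rewrite /a /cst /= !fctE.
    rewrite scalerBl scale1r [RHS]addrCA -scalerBr opprB [X in _ = _ + t *: X]addrC.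
    by rewrite subrKA -[z - y]opprB scalerN opprD [- _ - z]addrC addrA.
  move: xy xz; rewrite -ball_normE /= => xy xz.
  rewrite (le_lt_trans (ler_normD _ _))// !normrZ !ger0_norm ?subr_ge0//.
  (* The strict bound comes from the weight [t] of [x - y], so the endpoint [t = 0] is treated
     apart. *)
  have [->|tn0] := eqVneq t 0; first by rewrite mul0r add0r subr0 mul1r.
  have t_gt0 : 0 < t by rewrite lt_def tn0.
  have : t * `|x - y| < t * r by rewrite ltr_pM2l.
  have : (1 - t) * `|x - z| <= (1 - t) * r by apply: ler_wpM2l; [rewrite subr_ge0|exact: ltW].
  lra.
have dphi (t : R) : 0 <= t <= 1 ->
    is_diff t phi (fun h => 'd F (a t) (h *: (y - z)) - L (h *: (y - z))).
  move=> /ball_a /dF [dFa _].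
  have da : is_diff t a ( *:%R ^~ (y - z)).
    by apply: is_diff_eq; rewrite addr0.
  have dL : is_diff (a t) (F - (L : V -> W)) (('d F (a t) : V -> W) - (L : V -> W)).
    have ? : is_diff (a t) L L.
      by apply: DiffDef; [exact: linear_differentiable|exact: diff_lin].
    have ? := differentiableP dFa.
    exact: is_diffB.
  exact: is_diff_comp.
have -> : F y - F z - L (y - z) = phi 1 - phi 0.
  rewrite /phi /a /= !fctE /cst /= scale1r scale0r subrK add0r.
  by rewrite linearB !opprD !opprK addrACA.
apply: mean_value_inequality => t t01.
  by have ? := dphi t t01.
rewrite (@diff_val _ _ _ _ _ _ _ (dphi t t01)) scale1r.
by have [_] := dF _ (ball_a t t01).
Qed.

(** * Contractions depending on a parameter *)

Lemma norm_pair0l (R : realType) (P Z : normedModType R) (k : Z) :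
  `|(0 : P, k)| = `|k|.
Proof. by rewrite prod_normE/= normr0; apply/max_idPr. Qed.

Lemma norm_pair0r (R : realType) (P Z : normedModType R) (k : P) :
  `|(k, 0 : Z)| = `|k|.
Proof. by rewrite prod_normE/= normr0; apply/max_idPl. Qed.

(** Banach's theorem on the closed ball of radius [r]: [G z] is within [r / 2] of [G z0], itself
    within [r / 2] of [z0], so [G] preserves the ball. *)
Lemma half_contraction_fixpoint (R : realType) (Z : completeNormedModType R)
    (G : Z -> Z) (z0 : Z) (r : R) :
  0 <= r ->
  (forall z z', `|z - z0| <= r -> `|z' - z0| <= r ->
    `|G z - G z'| <= 2^-1 * `|z - z'|) ->
  `|G z0 - z0| <= r / 2 ->
  exists2 z, `|z - z0| <= r & z = G z.
Proof.
move=> r0 ctrG Gz0.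
pose B : set Z := [set z | `|z - z0| <= r].
have homG : set_fun B B G.
  move=> z /= zB; change (`|G z - z0| <= r).
  rewrite -(subrK (G z0) (G z)) -addrA.
  rewrite (le_trans (ler_normD _ _))// [leRHS]splitr lerD//.
  have z0B : `|z0 - z0| <= r by rewrite subrr normr0.
  by rewrite (le_trans (ctrG _ _ zB z0B))// mulrC ler_pM2r.
have ctr : is_contraction (mkfun_fun homG).
  exists (2^-1)%:nng; split; first by rewrite /= invf_lt1// ltr1n.
  by move=> [z z'] [/= zB z'B]; exact: ctrG.
have cB : closed B.
  apply: (@closed_comp _ _ (fun z => `|z - z0|) [set x | x <= r]).
    by move=> z _; apply: cvg_norm; apply: cvgB => //; exact: cvg_cst.
  exact: closed_le.
have B0 : B !=set0 by exists z0; rewrite /B/= subrr normr0.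
exact: (banach_fixed_point ctr cB B0).
Qed.

(** Implicit differentiation of [psi p = F (p, psi p)] leads to the equation [S k = D (k, S k)] with
    [D] the differential of [F]; its solution [S] is the candidate for the differential of [psi]. *)
Lemma half_implicit_linear (R : realType) (P : normedModType R)
    (Z : completeNormedModType R) (D : {linear (P * Z)%type -> Z}) :
  continuous D -> (forall k, `|D (0, k)| <= 2^-1 * `|k|) ->
  exists S : {linear P -> Z}, continuous S /\ forall k, S k = D (k, S k).
Proof.
move=> cD D2.
have DE k h h' : D (k, h) - D (k, h') = D (0, h - h').
  by rewrite -linearB/=; congr (D _); apply: injective_projections; rewrite /= ?subrr.
have /choice[S SE] k : exists h, h = D (k, h).
  (* The radius is the smallest one allowed: the image of the centre [0] is [D (k, 0)], which must
     have norm at most half the radius. *)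
  have [|||h _ hE] := @half_contraction_fixpoint _ _ (fun h => D (k, h)) 0
      (2 * `|D (k, 0)|).
  - by rewrite mulr_ge0.
  - by move=> z z' _ _; rewrite DE.
  - by rewrite subr0 mulrC mulrA mulVf ?mul1r.
  - by exists h.
have S_unique k h : h = D (k, h) -> h = S k.
  move=> hE; apply/eqP; rewrite -subr_eq0 -normr_eq0.
  have := D2 (h - S k); rewrite -(DE k) -hE -SE.
  have := normr_ge0 (h - S k); rewrite eq_le => -> ; lra.
(* Linearity follows from uniqueness: the linear combination of two solutions solves the equation
   for the combined parameter. *)
have Slin : linear S.
  move=> a u v; apply/esym/S_unique; rewrite [in LHS]SE [in LHS](SE v) -linearP/=.
  by congr (D _); apply: injective_projections.
pose SM := GRing.isLinear.Build _ _ _ _ _ Slin.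
pose SL : {linear P -> Z} := HB.pack S SM.
exists SL; split=> //.
have [c c0 Dc] := linear_lipschitz cD.
apply/linear_bounded_continuous/linear_boundedP.
(* The constant comes from [|S x| <= c * |x| + |S x| / 2]. *)
exists (2 * c); split; first exact: num_real.
move=> M cM x; apply: (@le_trans _ _ (2 * c * `|x|)); last first.
  by rewrite ler_wpM2r// ltW.
change (`|S x| <= 2 * c * `|x|).
have : `|S x| <= `|D (x, 0)| + `|D (0, S x)|.
  rewrite [in leLHS](SE x) (_ : (x, S x) = (x, 0) + (0, S x)).
    by rewrite linearD ler_normD.
  by apply: injective_projections; rewrite /= ?addr0 ?add0r.
have := D2 (S x); have := Dc (x, 0); rewrite norm_pair0r; lra.
Qed.

(** Write [h - h'] as [(D (k, h) - D' (k, h)) + D' (0, h - h')] and absorb the last term, at most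
    half of the left side. The bound evaluates both maps at the same vector [(k, h)]. *)
Lemma half_implicit_dist (R : realType) (P Z : normedModType R)
    (D D' : {linear (P * Z)%type -> Z}) (k : P) (h h' : Z) :
  h = D (k, h) -> h' = D' (k, h') ->
  (forall i, `|D' (0, i)| <= 2^-1 * `|i|) ->
  `|h - h'| <= 2 * `|D (k, h) - D' (k, h)|.
Proof.
move=> hE h'E D'2; have := D'2 (h - h').
have -> : (0, h - h') = (k, h) - (k, h').
  by apply: injective_projections; rewrite /= ?subrr.
rewrite linearB -h'E -hE.
have := ler_distD (D' (k, h)) h h'; lra.
Qed.

(** The remainder [r] of [psi] equals the remainder of [F] along the graph plus
    ['d F (p, psi p) (0, r)]. The second term has at most half the norm of [r] and is absorbed; the
    Lipschitz bound makes the first a little-o of [p' - p]. *)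
Lemma diff_fixpoint (R : realType) (P Z : normedModType R) (F : P * Z -> Z)
    (psi : P -> Z) (p : P) (S : {linear P -> Z}) (M : R) :
  differentiable F (p, psi p) ->
  (forall k, `|'d F (p, psi p) (0, k)| <= 2^-1 * `|k|) ->
  continuous S -> (forall k, S k = 'd F (p, psi p) (k, S k)) ->
  0 <= M ->
  (\forall p' \near p, psi p' = F (p', psi p') /\
    `|psi p' - psi p| <= M * `|p' - p|) ->
  differentiable psi p /\ 'd psi p = S :> (P -> Z).
Proof.
move=> dF D2 cS SE M0 near_psi.
have psi_cont : {for p, continuous psi}.
  apply/cvgrPdist_lt => e e0.
  have near_e : \forall p' \near p, M * `|p' - p| < e.
    have eM : 0 < e / (1 + M) by rewrite divr_gt0// ltr_pwDl.
    have := nbhsx_ballx p _ eM; apply: filterS => p'.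
    rewrite -ball_normE /= distrC ltr_pdivlMr ?ltr_pwDl// => /le_lt_trans; apply.
    by rewrite mulrC ler_wpM2l// lerDr.
  near=> p'; rewrite distrC (@le_lt_trans _ _ (M * `|p' - p|))//.
    suff [] : psi p' = F (p', psi p') /\ `|psi p' - psi p| <= M * `|p' - p| by [].
    by near: p'.
  by near: p'.
apply: diff_normP => // e e0.
(* The factor [1 + M] bounds the increment of [(p', psi p')] relative to [p' - p]; the factor 2 pays
   for absorbing half of [r]. *)
pose e' := e / (2 * (1 + M)).
have e'0 : 0 < e' by rewrite divr_gt0// mulr_gt0// ltr_pwDl.
have nF : \forall p' \near p, `|F (p', psi p') - F (p, psi p) -
    'd F (p, psi p) ((p', psi p') - (p, psi p))| <=
    e' * `|(p', psi p') - (p, psi p)|.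
  have := diff_norm dF e'0.
  by apply: (@cvg_pair _ _ _ (nbhs p) (nbhs p) (nbhs (psi p))).
near=> p'.
have [psi_p' lip] : psi p' = F (p', psi p') /\ `|psi p' - psi p| <= M * `|p' - p|.
  by near: p'.
have [psi_p _] := nbhs_singleton near_psi.
set r := psi p' - psi p - S (p' - p).
have rE : r = (F (p', psi p') - F (p, psi p) -
    'd F (p, psi p) ((p', psi p') - (p, psi p))) + 'd F (p, psi p) (0, r).
  rewrite -psi_p' -psi_p.
  have -> : (p', psi p') - (p, psi p) = (p' - p, S (p' - p)) + (0, r).
    by apply: injective_projections; rewrite /= ?addr0// [RHS]addrC subrK.
  by rewrite linearD -SE opprD addrA subrK.
have : `|(p', psi p') - (p, psi p)| <= (1 + M) * `|p' - p|.
  rewrite prod_normE/= ge_max mulrDl mul1r lerDl mulr_ge0//=.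
  by rewrite (le_trans lip)// lerDr.
have : `|F (p', psi p') - F (p, psi p) -
    'd F (p, psi p) ((p', psi p') - (p, psi p))| <=
    e' * `|(p', psi p') - (p, psi p)| by near: p'.
have e'M : e' * (1 + M) = e / 2.
  by rewrite /e' invfM mulrA -mulrA mulVf ?mulr1// gt_eqF// ltr_pwDl.
move=> nFp' /(ler_wpM2l (ltW e'0)); rewrite mulrA e'M.
have := D2 r; have := ler_normD (F (p', psi p') - F (p, psi p) -
    'd F (p, psi p) ((p', psi p') - (p, psi p))) ('d F (p, psi p) (0, r)).
rewrite -rE; lra.
Unshelve. all: by end_near. Qed.

(** An implicit function theorem in fixed-point form. Near the base point [F] differs from its
    linearization [L] by a map of Lipschitz constant 1/2, and [L] ignores [z], so [F] is a half
    contraction in [z]. *)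
Theorem parametric_fixpoint (R : realType) (P : normedModType R)
    (Z : completeNormedModType R) (F : P * Z -> Z) (O : set (P * Z))
    (p0 : P) (z0 : Z) (V0 : set Z) :
  finitely_spanned P -> finitely_spanned Z ->
  open O -> O (p0, z0) -> is_C 1 O F ->
  F (p0, z0) = z0 -> (forall k, 'd F (p0, z0) (0, k) = 0) ->
  nbhs z0 V0 ->
  exists (U : set P) (V : set Z) (psi : P -> Z),
    [/\ open_nbhs p0 U, open_nbhs z0 V, V `<=` V0, U `*` V `<=` O &
        is_C 1 U psi /\
        forall p, U p -> V (psi p) /\
          forall z, V z -> z = F (p, z) <-> z = psi p].
Proof.
move=> sP sZ oO O0 C1F F0 dF0 V0z0.
have h2 : (0 : R) < 2^-1 by rewrite invr_gt0.
have [L [cL L0 nearL]] : exists L : {linear (P * Z)%type -> Z},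
    [/\ continuous L, forall k, L (0, k) = 0 &
      \forall y \near (p0, z0), O y /\
        forall h, `|'d F y h - L h| <= 2^-1 * `|h|].
  exists ('d F (p0, z0)); split.
  - by apply: diff_continuous; exact: C1F.1.
  - exact: dF0.
  - exact: diff_near_uniform (finitely_spanned_pair sP sZ) oO C1F O0 h2.
have [c c0 Lc] := linear_lipschitz cL.
have /nbhs_ballP[rho /= rho0 near0] :
    \forall y \near (p0, z0), [/\ O y, V0 y.2 &
      forall h, `|'d F y h - L h| <= 2^-1 * `|h|].
  have n2 : \forall y \near (p0, z0), V0 y.2 by exact: (cvg_snd V0z0).
  by apply: filterS2 nearL n2 => y [].
have ballO y : ball (p0, z0) rho y -> O y by move=> /near0[].
have ballL y : ball (p0, z0) rho y ->
    differentiable F y /\ forall h, `|'d F y h - L h| <= 2^-1 * `|h|.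
  by move=> /near0[Oy _ dy]; exact: (conj (C1F.1 _ Oy) dy).
have strict := ball_strict_diff cL ballL.
have ctrF p z z' : ball p0 rho p -> ball z0 rho z -> ball z0 rho z' ->
    `|F (p, z) - F (p, z')| <= 2^-1 * `|z - z'|.
  move=> bp bz bz'; have := strict (p, z) (p, z') (conj bp bz) (conj bp bz').
  have -> : (p, z) - (p, z') = (0, z - z').
    by apply: injective_projections; rewrite //= subrr.
  by rewrite L0 subr0 norm_pair0l.
(* [c] bounds the linear part [L] and 1/2 the deviation of [F] from it. *)
pose M := c + 2^-1.
have lipF p p' z : ball p0 rho p -> ball p0 rho p' -> ball z0 rho z ->
    `|F (p, z) - F (p', z)| <= M * `|p - p'|.
  move=> bp bp' bz; have := strict (p, z) (p', z) (conj bp bz) (conj bp' bz).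
  have -> : (p, z) - (p', z) = (p - p', 0).
    by apply: injective_projections; rewrite //= subrr.
  rewrite norm_pair0r; have := Lc (p - p', 0); rewrite norm_pair0r.
  have := ler_normD (F (p, z) - F (p', z) - L (p - p', 0)) (L (p - p', 0)).
  by rewrite subrK /M mulrDl; lra.
have M0 : 0 < M by rewrite addr_gt0.
(* This moves [F (p, z0)] away from [z0] by at most [rho / 4], as the contraction on the closed ball
   of radius [rho / 2] requires; that ball lies inside the open ball [V]. *)
pose delta := Num.min rho (rho / (4 * M)).
have delta0 : 0 < delta by rewrite lt_min rho0 divr_gt0// mulr_gt0.
pose U := ball p0 delta; pose V := ball z0 rho.
have Urho p : U p -> ball p0 rho p by apply: le_ball; rewrite ge_min lexx.
have Vz0 : V z0 by exact: ballxx.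
have /choice[psi psiP] p : exists z, U p -> V z /\ z = F (p, z).
  have [Up|nUp] := pselect (U p); last by exists z0.
  have bp := Urho _ Up.
  have sub z : `|z - z0| <= rho / 2 -> V z.
    rewrite /V -ball_normE /= distrC => /le_lt_trans; apply.
    by rewrite ltr_pdivrMr// ltr_pMr// ltr1n.
  have [| | |z zV zE] := @half_contraction_fixpoint _ _ (fun z => F (p, z)) z0 (rho / 2).
  - by rewrite divr_ge0// ltW.
  - by move=> z z' /sub Vz /sub Vz'; exact: ctrF.
  - rewrite -[X in _ - X]F0 (le_trans (lipF _ _ _ bp (ballxx _ rho0) Vz0))//.
    move: Up; rewrite /U -ball_normE /= distrC lt_min => /andP[_ /ltW].
    rewrite ler_pdivlMr ?mulr_gt0//; lra.
  - by exists z => _; split; first exact: sub.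
have psi_unique p z : U p -> V z -> z = F (p, z) -> z = psi p.
  move=> Up Vz zE; have [Vpsi psiE] := psiP _ Up.
  apply/eqP; rewrite -subr_eq0 -normr_eq0 eq_le normr_ge0 andbT.
  have := ctrF p z (psi p) (Urho _ Up) Vz Vpsi; rewrite -zE -psiE; lra.
have oU : open U by exact: ball_open.
(* Passing through [F (p, psi p')] gives [|psi p' - psi p| <= M * |p' - p| + |psi p' - psi p| / 2],
   hence the factor 2. *)
have psi_lip p : U p -> \forall p' \near p, psi p' = F (p', psi p') /\
    `|psi p' - psi p| <= 2 * M * `|p' - p|.
  move=> Up; have [Vpsi psiE] := psiP _ Up.
  have : \forall p' \near p, U p' by exact: open_nbhs_nbhs.
  apply: filterS => p' Up'; have [Vpsi' psiE'] := psiP _ Up'; split=> //.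
  have := lipF p' p (psi p') (Urho _ Up') (Urho _ Up) Vpsi'; rewrite -psiE'.
  have := ctrF p (psi p') (psi p) (Urho _ Up) Vpsi' Vpsi; rewrite -psiE.
  have := ler_distD (F (p, psi p')) (psi p') (psi p); lra.
have graphB p : U p -> ball (p0, z0) rho (p, psi p).
  by move=> Up; split; [exact: Urho|exact: (psiP _ Up).1].
have dF2 p : U p -> forall k, `|'d F (p, psi p) (0, k)| <= 2^-1 * `|k|.
  move=> Up k; have [_ /(_ (0, k))] := ballL _ (graphB _ Up).
  by rewrite L0 subr0 norm_pair0l.
have dpsi p : U p -> differentiable psi p /\
    forall k, 'd psi p k = 'd F (p, psi p) (k, 'd psi p k).
  move=> Up; have [dFp _] := ballL _ (graphB _ Up).
  have [S [cS SE]] := half_implicit_linear (diff_continuous dFp) (dF2 _ Up).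
  have [|dp dpE] := diff_fixpoint dFp (dF2 _ Up) cS SE _ (psi_lip _ Up).
    by rewrite mulr_ge0// ltW.
  split; first exact: dp.
  by move=> k; have := SE k; rewrite -(congr1 (fun f => f k) dpE).
exists U, V, psi; split.
- by split=> //; exact: ballxx.
- by split=> //; exact: ball_open.
- by move=> z Vz; have [] := near0 (p0, z) (conj (ballxx _ rho0) Vz).
- by move=> [p z] [/= /Urho bp Vz]; apply: ballO.
split; last first.
  move=> p Up; have [Vpsi psiE] := psiP _ Up; split=> // z Vz.
  by split=> [/psi_unique|->//]; apply.
split=> [p /dpsi[]//|k p Up].
have [_ dE] := dpsi p Up.
have psi_cont : {for p, continuous psi}.
  exact: differentiable_continuous (dpsi p Up).1.
(* The vector [(k, 'd psi p k)] is frozen at [p]. By [half_implicit_dist], continuity of ['d F] in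
   this fixed direction suffices for continuity of ['d psi]. *)
have cont : (fun p' => 'd F (p', psi p') (k, 'd psi p k)) @ p -->
    'd F (p, psi p) (k, 'd psi p k).
  have C := C1F.2 (k, 'd psi p k) (p, psi p) (ballO _ (graphB _ Up)).
  apply: (@continuous_comp _ _ _ (fun p' => (p', psi p')) (fun y => 'd F y (k, 'd psi p k))).
    exact: cvg_pair.
  exact: C.
apply/cvgrPdist_le => e e0.
have near1 := (cvgrPdist_le _ _).1 cont _ (divr_gt0 e0 (ltr0n R 2)).
near=> p'.
have Up' : U p' by near: p'; exact: open_nbhs_nbhs.
have : `|'d F (p, psi p) (k, 'd psi p k) - 'd F (p', psi p') (k, 'd psi p k)| <= e / 2.
  by near: p'; exact: near1.
have [_ dE'] := dpsi p' Up'.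
have := half_implicit_dist (dE k) (dE' k) (dF2 p' Up').
by move=> /le_trans + close; apply; rewrite mulrC -ler_pdivlMr.
Unshelve. all: by end_near. Qed.

(** * Calculus of C^1 maps *)

(** Serves to run the contraction argument in the space of pairs of strategies and multipliers. *)
Lemma prod_complete (R : realType) (X Y : completeNormedModType R)
    (F : set_system ((X * Y)%type : normedModType R)) : ProperFilter F -> cauchy F -> cvg F.
Proof.
move=> FF /cauchyP cF.
have /cauchy_cvg c1 : cauchy (fst @ F).
  apply/cauchyP => e e0; have [y Fy] := cF e e0.
  exists y.1; change (F (fst @^-1` ball y.1 e)); apply: filterS Fy => z yz.
  by have [] : ball y.1 e z.1 /\ ball y.2 e z.2 := yz.
have /cauchy_cvg c2 : cauchy (snd @ F).
  apply/cauchyP => e e0; have [y Fy] := cF e e0.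
  exists y.2; change (F (snd @^-1` ball y.2 e)); apply: filterS Fy => z yz.
  by have [] : ball y.1 e z.1 /\ ball y.2 e z.2 := yz.
apply/cvg_ex; exists (lim (fst @ F), lim (snd @ F)).
have pairE : (fun x : X * Y => (x.1, x.2)) = id by apply/funext => -[].
have := @cvg_pair _ _ _ F _ _ _ _ _ fst snd c1 c2; rewrite pairE.
by move=> H A /H.
Qed.

HB.instance Definition _ (R : realType) (m n : nat) := Complete.on 'M[R]_(m, n).

HB.instance Definition _ (R : realType) (X Y : completeNormedModType R) :=
  Uniform_isComplete.Build (X * Y)%type (@prod_complete R X Y).

Section C1Calculus.
Variable R : realType.
Implicit Types U V W : normedModType R.

Lemma linear_family_continuous V W (D : V -> {linear V -> W}) (x a : V) :
  continuous (D x) ->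
  (forall e, 0 < e -> \forall y \near x, forall h, `|D y h - D x h| <= e * `|h|) ->
  {for (x, a), continuous (fun z : V * V => D z.1 z.2)}.
Proof.
move=> cD nD; apply/cvgrPdist_le => /= e e0.
have e2 : 0 < e / 2 by rewrite divr_gt0.
(* Vectors within distance 1 of [a] have norm at most [|a| + 1]. *)
have ea : 0 < e / 2 / (`|a| + 1) by rewrite divr_gt0// ltr_wpDl.
have n1 : \forall z \near (x, a), `|D x a - D x z.2| <= e / 2.
  have H : \forall y \near a, `|D x a - D x y| <= e / 2.
    exact: (cvgrPdist_le _ _).1 (cD a) _ e2.
  exact: (@cvg_snd _ _ (nbhs x) (nbhs a) _ _ H).
have n2 : \forall z \near (x, a), forall h,
    `|D z.1 h - D x h| <= e / 2 / (`|a| + 1) * `|h|.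
  by have H := nD _ ea; exact: (@cvg_fst _ _ (nbhs x) (nbhs a) _ _ H).
have n3 : \forall z \near (x, a), `|a - z.2| < 1.
  have H : \forall y \near a, `|a - y| < 1.
    by have := nbhsx_ballx a _ ltr01; rewrite -ball_normE.
  exact: (@cvg_snd _ _ (nbhs x) (nbhs a) _ _ H).
near=> z.
have zB : `|D x a - D x z.2| <= e / 2 by near: z; exact: n1.
have a1 : `|a - z.2| < 1 by near: z; exact: n3.
have : `|D z.1 z.2 - D x z.2| <= e / 2 / (`|a| + 1) * `|z.2|.
  by move: (z.2); near: z; exact: n2.
have : e / 2 / (`|a| + 1) * `|z.2| <= e / 2.
  rewrite mulrAC ler_pdivrMr ?ltr_wpDl// ler_pM2l//.
  have := ler_normB a (a - z.2); rewrite subKr => /le_trans; apply.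
  by rewrite lerD2l ltW.
have := ler_distD (D x z.2) (D x a) (D z.1 z.2).
rewrite (distrC (D x z.2)); lra.
Unshelve. all: by end_near. Qed.

(** Used to replace a differential by a formula that is only known on an open set. *)
Lemma open_eq_continuous V W (O : set V) (G G' : V -> W) (x : V) :
  open O -> O x -> (forall y, O y -> G y = G' y) ->
  {for x, continuous G'} -> {for x, continuous G}.
Proof.
move=> oO Ox GE; rewrite /prop_for /continuous_at (GE x Ox); apply: cvg_trans.
apply: near_eq_cvg.
have : \forall y \near x, O y by exact: open_nbhs_nbhs.
by apply: filterS => y Oy; rewrite GE.
Qed.

(** In the chain rule formula ['d F (k x) ('d k x h)] both the base point and the direction move
    with [x], so joint continuity is needed; finite spanning of [V] provides it. *)
Lemma is_C1_comp U V W (O : set U) (A : set V) (k : U -> V) (F : V -> W) :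
  finitely_spanned V -> open O -> open A -> is_C 1 O k ->
  (forall x, O x -> A (k x)) -> is_C 1 A F -> is_C 1 O (F \o k).
Proof.
move=> sV oO oA Ck kA CF.
have dE x : O x -> 'd (F \o k) x = 'd F (k x) \o 'd k x :> (U -> W).
  move=> Ox; apply: diff_comp; first exact: Ck.1.
  by apply: CF.1; exact: kA.
split=> [x Ox|h x Ox].
  apply: differentiable_comp; first exact: Ck.1.
  by apply: CF.1; exact: kA.
have kx : {for x, continuous k}.
  by apply: differentiable_continuous; exact: Ck.1.
have C := Ck.2 h x Ox.
have joint : {for (k x, 'd k x h), continuous (fun z : V * V => 'd F (z.1) (z.2))}.
  apply: (@linear_family_continuous _ _ (fun y => 'd F y)).
    by apply: diff_continuous; apply: CF.1; exact: kA.
  move=> e e0; have := diff_near_uniform sV oA CF (kA _ Ox) e0.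
  by apply: filterS => y [].
apply: (@open_eq_continuous _ _ O _ (fun x' => 'd F (k x') ('d k x' h))) => //.
  by move=> y Oy; exact: (congr1 (fun f => f h) (dE y Oy)).
have cp : {for x, continuous (fun x' => (k x', 'd k x' h))} by exact: cvg_pair.
exact: (continuous_comp cp joint).
Qed.

Lemma is_C1_cst V W (O : set V) (a : W) : is_C 1 O (fun _ : V => a).
Proof.
split=> [x _|h x _]; first exact: differentiable_cst.
have -> : (fun x => 'd (fun _ : V => a) x h) = cst 0.
  by apply/funext => y; rewrite diff_cst.
exact: cvg_cst.
Qed.

Lemma bounded_linear_is_diff V W (L : V -> W) (c : R) (x : V) :
  linear L -> (forall x, `|L x| <= c * `|x|) -> is_diff x L L.
Proof.
move=> Llin Lc.
pose LM := GRing.isLinear.Build _ _ _ _ _ Llin.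
pose LL : {linear V -> W} := HB.pack L LM.
have cL : continuous LL.
  apply/linear_bounded_continuous/linear_boundedP.
  exists c; split; first exact: num_real.
  move=> M cM y; apply: (le_trans (Lc y)).
  by rewrite ler_wpM2r// ltW.
apply: DiffDef; first exact: (@linear_differentiable _ _ _ LL x cL).
exact: (@diff_lin _ _ _ LL x cL).
Qed.

Lemma is_C1_linear V W (L : V -> W) (c : R) : linear L ->
  (forall x, `|L x| <= c * `|x|) -> is_C 1 setT L.
Proof.
move=> Llin Lc; have dL x := bounded_linear_is_diff x Llin Lc.
split=> [x _|h x _]; first by have [] := dL x.
rewrite (_ : (fun x => 'd L x h) = cst (L h)); first exact: cvg_cst.
by apply/funext => y; have [_ ->] := dL y.
Qed.

Lemma is_C2_C1 V W (O : set V) (F : V -> W) : is_C 2 O F -> is_C 1 O F.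
Proof.
move=> [dF C1F]; split=> // h x Ox.
exact: differentiable_continuous ((C1F h).1 x Ox).
Qed.

Lemma is_C1_subset V W (A B : set V) (F : V -> W) :
  A `<=` B -> is_C 1 B F -> is_C 1 A F.
Proof.
by move=> AB [dF cF]; split=> [x /AB|h x /AB]; [exact: dF|exact: cF].
Qed.

Lemma is_C1_compT U V W (k : U -> V) (F : V -> W) :
  finitely_spanned V -> is_C 1 setT k -> is_C 1 setT F ->
  is_C 1 setT (fun x => F (k x)).
Proof.
by move=> sV Ck CF; exact: (is_C1_comp sV openT openT Ck (fun x _ => I) CF).
Qed.

Lemma is_C1D V W (F G : V -> W) :
  is_C 1 setT F -> is_C 1 setT G -> is_C 1 setT (fun x => F x + G x).
Proof.
move=> [dF cF] [dG cG].
have dE x : 'd (F + G) x = 'd F x \+ 'd G x :> (V -> W).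
  by apply: diffD; [exact: dF|exact: dG].
split=> [x _|h x _]; first exact: (differentiableD (dF x I) (dG x I)).
have -> : (fun x => 'd (fun x => F x + G x) x h) =
          (fun x => 'd F x h + 'd G x h).
  by apply/funext => y; exact: (congr1 (fun f => f h) (dE y)).
by apply: cvgD; [exact: cF|exact: cG].
Qed.

Lemma is_C1B V W (F G : V -> W) :
  is_C 1 setT F -> is_C 1 setT G -> is_C 1 setT (fun x => F x - G x).
Proof.
move=> [dF cF] [dG cG].
have dE x : 'd (F - G) x = 'd F x \- 'd G x :> (V -> W).
  by apply: diffB; [exact: dF|exact: dG].
split=> [x _|h x _]; first exact: (differentiableB (dF x I) (dG x I)).
have -> : (fun x => 'd (fun x => F x - G x) x h) =
          (fun x => 'd F x h - 'd G x h).
  by apply/funext => y; exact: (congr1 (fun f => f h) (dE y)).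
by apply: cvgB; [exact: cF|exact: cG].
Qed.

Lemma is_C1_sum V W (n : nat) (F : 'I_n -> V -> W) :
  (forall i, is_C 1 setT (F i)) -> is_C 1 setT (fun x => \sum_i F i x).
Proof.
move=> CF.
have -> : (fun x => \sum_i F i x) = \sum_i F i.
  by apply/funext => x; rewrite fct_sumE.
apply: (big_ind (fun G : V -> W => is_C 1 setT G)) => [|G G'|i _].
- exact: (is_C1_cst _ 0).
- exact: is_C1D.
- exact: CF.
Qed.

Lemma is_C1M V (F G : V -> R) :
  is_C 1 setT F -> is_C 1 setT G -> is_C 1 setT (fun x => F x * G x).
Proof.
move=> [dF cF] [dG cG].
have dE x : 'd (F * G) x = F x \*: 'd G x \+ G x \*: 'd F x :> (V -> R).
  by apply: diffM; [exact: dF|exact: dG].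
split=> [x _|h x _]; first exact: (differentiableM (dF x I) (dG x I)).
have -> : (fun x => 'd (fun x => F x * G x) x h) =
          (fun x => F x * 'd G x h + G x * 'd F x h).
  by apply/funext => y; exact: (congr1 (fun f => f h) (dE y)).
apply: cvgD; apply: cvgM.
- exact: (differentiable_continuous (dF x I)).
- exact: cG.
- exact: (differentiable_continuous (dG x I)).
- exact: cF.
Qed.

Lemma is_C1Zl V W (F : V -> R) (w : W) :
  is_C 1 setT F -> is_C 1 setT (fun x => F x *: w).
Proof.
move=> [dF cF].
have dE x : 'd (fun z => F z *: w) x = (fun z => 'd F x z *: w) :> (V -> W).
  by apply: diffZl; exact: dF.
split=> [x _|h x _]; first exact: (differentiableZl _ (dF x I)).
have -> : (fun x => 'd (fun x => F x *: w) x h) = (fun x => 'd F x h *: w).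
  by apply/funext => y; exact: (congr1 (fun f => f h) (dE y)).
by apply: cvgZr_tmp; exact: cF.
Qed.

Lemma is_C1_pair U V W (O : set U) (F : U -> V) (G : U -> W) :
  open O -> is_C 1 O F -> is_C 1 O G -> is_C 1 O (fun x => (F x, G x)).
Proof.
move=> oO [dF cF] [dG cG].
have dE x : O x -> 'd (fun y => (F y, G y)) x = (fun y => ('d F x y, 'd G x y)) :> (U -> V * W).
  by move=> Ox; apply: diff_pair; [exact: dF|exact: dG].
split=> [x Ox|h x Ox]; first exact: (differentiable_pair (dF x Ox) (dG x Ox)).
apply: (@open_eq_continuous _ _ O _ (fun y => ('d F y h, 'd G y h))) => //.
  by move=> y Oy; exact: (congr1 (fun f => f h) (dE y Oy)).
by apply: cvg_pair; [exact: cF|exact: cG].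
Qed.

Lemma is_C1_row V (n : nat) (F : V -> 'rV[R]_n) :
  (forall i, is_C 1 setT (fun x => F x 0 i)) -> is_C 1 setT F.
Proof.
move=> CF; rewrite (_ : F = fun x => \sum_i F x 0 i *: delta_mx 0 i).
  by apply: is_C1_sum => i; exact: is_C1Zl.
by apply/funext => x; exact: row_sum_delta.
Qed.

Lemma is_C1_id V : is_C 1 setT (@id V).
Proof. by apply: (@is_C1_linear _ _ _ 1) => // x; rewrite mul1r. Qed.

Lemma is_C1_fst V W : is_C 1 setT (@fst V W).
Proof.
by apply: (@is_C1_linear _ _ _ 1) => // x; rewrite mul1r prod_normE le_max lexx.
Qed.

Lemma is_C1_snd V W : is_C 1 setT (@snd V W).
Proof.
apply: (@is_C1_linear _ _ _ 1) => // x.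
by rewrite mul1r prod_normE le_max lexx orbT.
Qed.

Lemma is_C1_coord (n : nat) (i : 'I_n) :
  is_C 1 setT (fun x : 'rV[R]_n => x 0 i).
Proof.
apply: (@is_C1_linear _ _ _ 1) => [a x y|x]; first by rewrite !mxE.
rewrite mul1r [leRHS]/Num.Def.normr/= mx_normrE.
exact: (le_bigmax _ _ (0, i)).
Qed.

End C1Calculus.

(** * Tilting a localization *)

Section Localization.
Variable R : realType.
Implicit Types Q W Z : normedModType R.

(** Pointwise reading of the graph equality, with the inclusion of [sigma @] [U] in [V] made
    explicit. *)
Lemma C1_localizationP Q Z (Phi : Q -> set Z) (q0 : Q) (z0 : Z) :
  C1_localization Phi q0 z0 <->
  Phi q0 z0 /\ exists (U : set Q) (V : set Z) (sigma : Q -> Z),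
    [/\ open_nbhs q0 U, open_nbhs z0 V, is_C 1 U sigma &
        forall q, U q -> V (sigma q) /\
          forall z, V z -> Phi q z <-> z = sigma q].
Proof.
split=> -[Phi0 [U [V [sigma [U0 V0 Cs gphE]]]]]; split=> //;
  exists U, V, sigma; split=> //.
  have gphP q z : (Phi q z /\ U q /\ V z) <-> (U q /\ z = sigma q).
    by have := congr1 (fun A : set (Q * Z) => A (q, z)) gphE; rewrite /= => <-.
  move=> q Uq; split; first by have [_ []] := (gphP q (sigma q)).2 (conj Uq erefl).
  move=> z Vz; split=> [Pz|zE].
    by have [] := (gphP q z).1 (conj Pz (conj Uq Vz)).
  by have [] := (gphP q z).2 (conj Uq zE).
apply/seteqP; split=> -[q z] /=.
  by move=> [Pz [Uq Vz]]; split=> //; exact/((gphE q Uq).2 z Vz).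
by move=> [Uq ->]; have [Vs sE] := gphE q Uq; split=> //; exact/sE.
Qed.

(** The localization is composed with the affine embedding [q |-> (q, w0)]; [V] is unchanged. *)
Lemma C1_localization_restrict Q W Z (S : Q * W -> set Z) (q0 : Q) (w0 : W)
    (z0 : Z) :
  finitely_spanned Q -> finitely_spanned W ->
  C1_localization S (q0, w0) z0 ->
  C1_localization (fun q => S (q, w0)) q0 z0.
Proof.
move=> sQ sW /C1_localizationP[S0 [U [V [sigma [[oU U0] V0 Cs sP]]]]].
apply/C1_localizationP; split=> //.
pose i q : Q * W := (q, w0).
have icont : continuous i by move=> q; apply: cvg_pair; [exact: cvg_id|exact: cvg_cst].
have oiU : open (i @^-1` U) by exact: open_comp.
exists (i @^-1` U), V, (sigma \o i); split=> //.
- apply: (is_C1_comp (finitely_spanned_pair sQ sW) oiU oU _ _ Cs) => //.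
  apply: is_C1_pair => //; last exact: is_C1_cst.
  exact: is_C1_subset (@subsetT _ _) (@is_C1_id _ _).
- by move=> q Uq; exact: sP.
Qed.

Lemma C1_localization_tilt Q W (Z : completeNormedModType R)
    (S : Q * W -> set Z) (H : Z * W -> Q) (q0 : Q) (w0 : W) (z0 : Z) :
  finitely_spanned Q -> finitely_spanned W -> finitely_spanned Z ->
  is_C 1 setT H ->
  (forall q w z, S (q, w) z <-> S (q - (H (z, w) - H (z, w0)), w0) z) ->
  C1_localization (fun q => S (q, w0)) q0 z0 ->
  C1_localization S (q0, w0) z0.
Proof.
move=> sQ sW sZ CH Stilt /C1_localizationP[S0 [U [V [sigma]]]].
move=> [[oU U0] [oV V0] Cs sP].
(* The tilted parameter, as a function of [((q, w), z)]. *)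
pose a (y : (Q * W) * Z) : Q := y.1.1 - (H (y.2, y.1.2) - H (y.2, w0)).
have sP0 := finitely_spanned_pair sQ sW.
have Ca : is_C 1 setT a.
  have sZW := finitely_spanned_pair sZ sW.
  have C1 := is_C1_compT sP0 (@is_C1_fst _ (Q * W)%type Z) (@is_C1_fst _ Q W).
  have C2 := is_C1_compT sP0 (@is_C1_fst _ (Q * W)%type Z) (@is_C1_snd _ Q W).
  have C3 := @is_C1_snd _ (Q * W)%type Z.
  have C4 := is_C1_compT sZW (is_C1_pair openT C3 C2) CH.
  have C5 := is_C1_compT sZW (is_C1_pair openT C3 (is_C1_cst _ w0)) CH.
  exact: (is_C1B C1 (is_C1B C4 C5)).
have acont : continuous a by move=> y; exact: differentiable_continuous (Ca.1 y I).
pose O := a @^-1` U.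
have oO : open O by exact: open_comp.
have aE z : a ((q0, w0), z) = q0 by rewrite /a /= subrr subr0.
have CF : is_C 1 O (sigma \o a).
  exact: (is_C1_comp sQ oO oU (is_C1_subset (@subsetT _ _) Ca) _ Cs).
have O0 : O ((q0, w0), z0) by rewrite /O /= aE.
have F0 : (sigma \o a) ((q0, w0), z0) = z0.
  by rewrite /= aE; apply/esym/((sP q0 U0).2 z0 V0).
(* On the slice through [(q0, w0)] the map [a] is constantly [q0], so the composite with
   [z |-> ((q0, w0), z)] is constant and the chain rule gives 0. *)
have dF0 k : 'd (sigma \o a) ((q0, w0), z0) (0, k) = 0.
  have cstE : (sigma \o a) \o (fun z => ((q0, w0), z)) = cst (sigma q0).
    by apply/funext => z /=; rewrite aE.
  have [di diE] : is_diff z0 (fun z => ((q0, w0), z)) (fun k => (0, k)).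
    exact: is_diff_pair.
  have := @diff_comp _ _ _ _ (fun z => ((q0, w0), z)) (sigma \o a) z0
    di (CF.1 _ O0).
  rewrite cstE diff_cst diE.
  by move=> /(congr1 (fun f => f k)) /= <-.
have [U' [V' [psi [U'0 V'0 V'V UVO [Cpsi psiP]]]]] :=
  parametric_fixpoint sP0 sZ oO O0 CF F0 dF0 (open_nbhs_nbhs (conj oV V0)).
apply/C1_localizationP; split=> //.
exists U', V', psi; split=> // -[q w] Up; have [Vpsi psiE] := psiP _ Up.
split=> // z Vz; rewrite -(psiE z Vz).
(* Both inclusions of the fixed-point theorem are used: the tilted parameter lies in [U] and [z] in
   [V], where [sigma] describes the solutions at [w0]. *)
have Ua : U (a ((q, w), z)) by exact: (UVO ((q, w), z) (conj Up Vz)).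
have [_ /(_ z (V'V z Vz)) <-] := sP _ Ua.
exact: Stilt.
Qed.
End Localization.

(** * The KKT mapping *)

Section Submxrow.
Variables (R : realType) (N : nat) (n : 'I_N -> nat) (k : 'I_N).
Local Notation X := 'rV[R]_(\sum_k n k).

Lemma linear_submxrow : linear (fun x : X => submxrow x k).
Proof. by move=> a x y; apply/rowP => i; rewrite !mxE. Qed.

Lemma norm_submxrow (x : X) : `|submxrow x k| <= 1 * `|x|.
Proof.
rewrite mul1r [leLHS]/Num.Def.normr/= mx_normrE.
apply: bigmax_le => // -[i j] _ /=.
rewrite [leRHS]/Num.Def.normr/= mx_normrE mxE.
exact: (le_bigmax _ _ (i, tagnat.Rank k j)).
Qed.

Lemma is_C1_submxrow : is_C 1 setT (fun x : X => submxrow x k).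
Proof. exact: is_C1_linear linear_submxrow norm_submxrow. Qed.

Lemma is_diff_submxrow (x : X) :
  is_diff x (fun x : X => submxrow x k) (fun x => submxrow x k).
Proof. exact: bounded_linear_is_diff linear_submxrow norm_submxrow. Qed.

End Submxrow.

Section KKT.
Variables (R : realType) (N : nat) (n m d : 'I_N -> nat).
Variable f : forall k, 'rV[R]_(\sum_k n k) * 'rV[R]_(d k) -> R.
Variable g : forall k, 'I_(m k) -> 'rV[R]_(n k) * 'rV[R]_(d k) -> R.
Arguments f : clear implicits.
Arguments g : clear implicits.

Local Notation X := 'rV[R]_(\sum_k n k).
Local Notation Lam := 'rV[R]_(\sum_k m k).
Local Notation W := 'rV[R]_(\sum_k d k).

(** This is the map H of the opening explanation; its values are ordered like [(u, v)], so that they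
    can be subtracted from [q]. *)
Definition kkt_map (y : (X * Lam) * W) : Lam * X :=
  (\mxrow_k \row_i g k i (submxrow y.1.1 k, submxrow y.2 k),
   \mxrow_k block_grad k (fun x =>
     lagrangian f g x (submxrow y.1.2 k) (submxrow y.2 k)) y.1.1).

(** The KKT system as a condition on the multipliers and the residual [r] alone; for inequality
    constraints [r.1] holds the slacks [u - g], complementary to [lam]. *)
Definition kkt_residual (s : 'I_N -> nat) (lam : Lam) (r : Lam * X) : Prop :=
  forall k : 'I_N,
    [/\ submxrow r.2 k = 0,
        forall i : 'I_(m k), (i < s k)%N -> submxrow r.1 k 0 i = 0 &
        forall j : 'I_(m k), (s k <= j)%N ->
          [/\ 0 <= submxrow lam k 0 j, 0 <= submxrow r.1 k 0 j &
              submxrow lam k 0 j * submxrow r.1 k 0 j = 0]].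

Lemma S_KKT_residual (s : 'I_N -> nat) (q : Lam * X) (w : W) (z : X * Lam) :
  S_KKT s f g (q, w) z <-> kkt_residual s z.2 (q - kkt_map (z, w)).
Proof.
case: z q => [x lam] [u v].
have e1 k : submxrow (v - (kkt_map ((x, lam), w)).2) k = submxrow v k -
    block_grad k (fun y => lagrangian f g y (submxrow lam k) (submxrow w k)) x.
  by rewrite submxrowB mxrowK.
have e2 k i : submxrow (u - (kkt_map ((x, lam), w)).1) k 0 i =
    submxrow u k 0 i - g k i (submxrow x k, submxrow w k).
  by rewrite submxrowB mxrowK !mxE.
split=> [H k|H k]; have [h1 h2 h3] := H k.
  split=> [|i si|j sj].
  - by rewrite e1 h1 subrr.
  - by rewrite e2 h2// subrr.
  - have [l0 gu lg] := h3 j sj; rewrite e2; split=> //; first by rewrite subr_ge0.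
    by rewrite -opprB mulrN lg oppr0.
split=> [|i si|j sj].
- by apply/subr0_eq; rewrite -e1.
- by apply/esym/subr0_eq; rewrite -e2 h2.
- have [l0 gu lg] := h3 j sj; move: gu lg; rewrite e2 subr_ge0 => gu lg.
  by split=> //; rewrite -opprB mulrN lg oppr0.
Qed.

(** Both problems have the same residual, [q - kkt_map (z, w)], and the same multipliers. *)
Lemma S_KKT_tilt (s : 'I_N -> nat) (q : Lam * X) (w w0 : W) (z : X * Lam) :
  S_KKT s f g (q, w) z <->
  S_KKT s f g (q - (kkt_map (z, w) - kkt_map (z, w0)), w0) z.
Proof.
rewrite !S_KKT_residual.
have -> // : q - (kkt_map (z, w) - kkt_map (z, w0)) - kkt_map (z, w0) =
  q - kkt_map (z, w).
by rewrite opprB addrA addrAC addrK.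
Qed.

(** Rewrites the partial gradient by differentials of [f k] and [g k j] in fixed directions, for
    which [is_C 2] yields [is_C 1] by definition. *)
Lemma block_grad_lagrangian k (lam : 'rV[R]_(m k)) (w : 'rV[R]_(d k)) (x : X)
    (i : 'I_(n k)) :
  differentiable (f k) (x, w) ->
  (forall j, differentiable (g k j) (submxrow x k, w)) ->
  block_grad k (fun y => lagrangian f g y lam w) x 0 i =
  'd (f k) (x, w) (delta_mx 0 (tagnat.Rank k i), 0) +
  \sum_j lam 0 j * 'd (g k j) (submxrow x k, w)
    (submxrow (delta_mx 0 (tagnat.Rank k i)) k, 0).
Proof.
move=> df dg; rewrite /block_grad mxE; move: (delta_mx _ _) => e.
have fD : is_derive x e (fun y => f k (y, w)) ('d (f k) (x, w) (e, 0)).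
  have [dp dpE] : is_diff x (fun y : X => (y, w)) (fun e => (e, 0)).
    exact: is_diff_pair.
  have dc := @differentiable_comp _ _ _ _ (fun y : X => (y, w)) (f k) x dp df.
  apply: DeriveDef; first exact: diff_derivable.
  rewrite (deriveE _ dc).
  have := congr1 (fun F => F e) (@diff_comp _ _ _ _ (fun y : X => (y, w)) (f k) x dp df).
  by rewrite /= dpE.
have gD j : is_derive x e (fun y => g k j (submxrow y k, w))
    ('d (g k j) (submxrow x k, w) (submxrow e k, 0)).
  have [dp dpE] : is_diff x (fun y : X => (submxrow y k, w)) (fun e => (submxrow e k, 0)).
    have ? := is_diff_submxrow k x.
    exact: is_diff_pair.
  have dc := @differentiable_comp _ _ _ _ (fun y : X => (submxrow y k, w)) (g k j) x dp (dg j).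
  apply: DeriveDef; first exact: diff_derivable.
  rewrite (deriveE _ dc).
  have := congr1 (fun F => F e) (@diff_comp _ _ _ _ (fun y : X => (submxrow y k, w)) (g k j) x dp (dg j)).
  by rewrite /= dpE.
have sD := is_deriveD fD (is_derive_sum (fun j => is_deriveZ (lam 0 j) (gD j))).
rewrite -[RHS](@derive_val _ _ _ _ _ _ _ sD).
congr ('D_e _ x).
by apply/funext => y; rewrite /lagrangian !fctE fct_sumE.
Qed.

Lemma is_C1_kkt_map :
  (forall k, is_C 2 setT (f k)) -> (forall k i, is_C 2 setT (g k i)) ->
  is_C 1 setT kkt_map.
Proof.
move=> hf hg.
have sX := @finitely_spanned_rV R (\sum_k n k).
have sLam := @finitely_spanned_rV R (\sum_k m k).
have sW := @finitely_spanned_rV R (\sum_k d k).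
have sXL := finitely_spanned_pair sX sLam.
have Cx : is_C 1 setT (fun y : (X * Lam) * W => y.1.1).
  exact: (is_C1_compT sXL (@is_C1_fst _ (X * Lam)%type W) (@is_C1_fst _ X Lam)).
have Cxk k : is_C 1 setT (fun y : (X * Lam) * W => submxrow y.1.1 k).
  exact: (is_C1_compT sX Cx (is_C1_submxrow R n k)).
have Clam k j : is_C 1 setT (fun y : (X * Lam) * W => submxrow y.1.2 k 0 j).
  have C1 := is_C1_compT sXL (@is_C1_fst _ (X * Lam)%type W) (@is_C1_snd _ X Lam).
  have C2 := is_C1_compT sLam C1 (is_C1_submxrow R m k).
  exact: (is_C1_compT (@finitely_spanned_rV R (m k)) C2 (is_C1_coord R j)).
have Cwk k : is_C 1 setT (fun y : (X * Lam) * W => submxrow y.2 k).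
  exact: (is_C1_compT sW (@is_C1_snd _ (X * Lam)%type W) (is_C1_submxrow R d k)).
have sg k := finitely_spanned_pair (@finitely_spanned_rV R (n k))
  (@finitely_spanned_rV R (d k)).
have sf k := finitely_spanned_pair sX (@finitely_spanned_rV R (d k)).
apply: is_C1_pair; first exact: openT.
  apply: is_C1_row => j; set k := tagnat.sig1 j.
  rewrite (_ : (fun y => _) = fun y : (X * Lam) * W =>
      g k (tagnat.sig2 j) (submxrow y.1.1 k, submxrow y.2 k)); last first.
    by apply/funext => y; rewrite !mxE.
  exact: (is_C1_compT (sg k) (is_C1_pair openT (Cxk k) (Cwk k))
    (is_C2_C1 (hg k _))).
apply: is_C1_row => j; set k := tagnat.sig1 j.
(* The position [j] in the long row is coordinate [tagnat.sig2 j] of player [k]; [e] is the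
   corresponding unit vector. *)
pose e : X := delta_mx 0 (tagnat.Rank k (tagnat.sig2 j)).
rewrite (_ : (fun y => _) = fun y : (X * Lam) * W =>
    'd (f k) (y.1.1, submxrow y.2 k) (e, 0) +
    \sum_i submxrow y.1.2 k 0 i *
      'd (g k i) (submxrow y.1.1 k, submxrow y.2 k) (submxrow e k, 0)); last first.
  apply/funext => y; rewrite mxE block_grad_lagrangian//.
    by apply: (hf k).1.
  by move=> i; apply: (hg k i).1.
apply: is_C1D.
  exact: (is_C1_compT (sf k) (is_C1_pair openT Cx (Cwk k)) ((hf k).2 (e, 0))).
apply: is_C1_sum => i; apply: is_C1M; first exact: Clam.
exact: (is_C1_compT (sg k) (is_C1_pair openT (Cxk k) (Cwk k))
  ((hg k i).2 (submxrow e k, 0))).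
Qed.

End KKT.

Unset Implicit Arguments.

Theorem corollary4p2 (R : realType) (N : nat) (n m d s : 'I_N -> nat)
  (hs : forall k, (s k <= m k)%N)
  (f : forall k, 'rV[R]_(\sum_k n k) * 'rV[R]_(d k) -> R)
  (g : forall k, 'I_(m k) -> 'rV[R]_(n k) * 'rV[R]_(d k) -> R)
  (hf : forall k, is_C 2 setT (f k))
  (hg : forall k (i : 'I_(m k)), is_C 2 setT (g k i))
  (ubar : 'rV[R]_(\sum_k m k)) (vbar : 'rV[R]_(\sum_k n k))
  (wbar : 'rV[R]_(\sum_k d k))
  (xbar : 'rV[R]_(\sum_k n k)) (lambar : 'rV[R]_(\sum_k m k))
  (hbar : S_KKT s f g (ubar, vbar, wbar) (xbar, lambar)) :
  C1_localization (S_KKT s f g) (ubar, vbar, wbar) (xbar, lambar) <->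
  C1_localization (T_KKT s f g wbar) (ubar, vbar) (xbar, lambar).
Proof.
have sX := @finitely_spanned_rV R (\sum_k n k).
have sLam := @finitely_spanned_rV R (\sum_k m k).
have sW := @finitely_spanned_rV R (\sum_k d k).
(* [T_KKT] is by definition the slice of [S_KKT] at [wbar], so restriction gives one direction and
   tilting by [kkt_map] the other. *)
split; first exact: C1_localization_restrict (finitely_spanned_pair sLam sX) sW.
apply: (@C1_localization_tilt R _ _ _ (S_KKT s f g) (kkt_map f g)).
- exact: finitely_spanned_pair.
- exact: sW.
- exact: finitely_spanned_pair.
- exact: is_C1_kkt_map.
- by move=> q w z; exact: S_KKT_tilt.
Qed.
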